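(* Let $X$ be a topological vector space, let $Y$ be a locally convex topological vector space ordered by a convex cone $Y_+$ with $\operatorname{int} Y_+\neq\emptyset$, let $D\subseteq X$ be nonempty, and let $f:X\to 2^Y$ be a set-valued map. Then the following four properties are equivalent: (1) ($f$ is subconvexlike on $D$) there exists $\theta\in\operatorname{int}Y_+$ such that for all $x^1,x^2\in D$, all $\alpha\in(0,1)$ and all $\varepsilon>0$ there exists $x^3\in D$ with $\varepsilon\theta+\alpha f(x^1)+(1-\alpha)f(x^2)\subseteq f(x^3)+Y_+$. (2) ($f$ is sub-convexlike on $D$) there exists $u\in U$ such that for all $x^1,x^2\in D$, all $\alpha\in(0,1)$ and all $\varepsilon>0$ there exists $x^3\in D$ with $\varepsilon u+\alpha f(x^1)+(1-\alpha)f(x^2)\subseteq f(x^3)+Y_+$. (3) ($f$ is strictly subconvexlike on $D$) there exists $\theta\in\operatorname{int}Y_+$ such that for all $x^1,x^2\in D$, all $\alpha\in(0,1)$ and all $\varepsilon>0$ there exists $x^3\in D$ with $\varepsilon\theta+\alpha f(x^1)+(1-\alpha)f(x^2)\subseteq f(x^3)+\operatorname{int}Y_+$. (4) ($f$ is strictly sub-convexlike on $D$) there exists $u\in U$ such that for all $x^1,x^2\in D$, all $\alpha\in(0,1)$ and all $\varepsilon>0$ there exists $x^3\in D$ with $\varepsilon u+\alpha f(x^1)+(1-\alpha)f(x^2)\subseteq f(x^3)+\operatorname{int}Y_+$. Here $U$ is the set of all bounded set-valued functions from $X$ to $2^Y$.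
   Context: All vector spaces are real. $2^Y$ is the power set of $Y$. A subset $Y_+\subseteq Y$ is a convex cone if $\lambda_1y_1+\lambda_2y_2\in Y_+$ for all $y_1,y_2\in Y_+$ and all real $\lambda_1,\lambda_2\ge 0$; $\operatorname{int}Y_+$ is its interior. Sums and scalar multiples of sets are taken elementwise: $A+B=\{a+b:a\in A,b\in B\}$, $v+A=\{v+a:a\in A\}$, $\lambda A=\{\lambda a:a\in A\}$. A set-valued function $u:X\to 2^Y$ (with nonempty values) is bounded if its range $u(X)=\bigcup_{x\in X}u(x)$ is a bounded subset of $Y$. In an inclusion such as $\varepsilon u+A\subseteq B$, the symbol $u$ stands for the range $u(X)$, i.e. the inclusion means $\varepsilon u(x)+A\subseteq B$ for every $x\in X$. *)

(* Defs.v *)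
From HB Require Import structures.
From mathcomp Require Import all_boot all_order all_algebra.
From mathcomp Require Import all_classical all_reals all_analysis.

Set Implicit Arguments.
Unset Strict Implicit.
Unset Printing Implicit Defensive.

Import Order.TTheory GRing.Theory Num.Theory.

Local Open Scope classical_set_scope.
Local Open Scope ring_scope.

Definition set_add (V : zmodType) (A B : set V) : set V :=
  [set a + b | a in A & b in B].

Definition set_trans (V : zmodType) (v : V) (A : set V) : set V :=
  [set v + a | a in A].

Definition set_scale (R : pzRingType) (V : lmodType R) (l : R) (A : set V) :
    set V :=
  [set l *: a | a in A].

Notation "A `+` B" := (set_add A B) : classical_set_scope.
Notation "v `+: A" := (set_trans v A)
  (at level 50, A at level 49) : classical_set_scope.
Notation "l `*: A" := (set_scale l A)
  (at level 40, A at level 39) : classical_set_scope.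

Definition convex_cone (R : realType) (Y : lmodType R) (Yp : set Y) : Prop :=
  forall (y1 y2 : Y) (l1 l2 : R),
    Yp y1 -> Yp y2 -> 0 <= l1 -> 0 <= l2 -> Yp (l1 *: y1 + l2 *: y2).

(* Von Neumann boundedness; the library's [bounded_set] requires a norm. *)
Definition tvs_bounded (R : realType) (Y : topologicalLmodType R)
    (A : set Y) : Prop :=
  forall V : set Y, nbhs 0 V ->
    exists2 s : R, 0 < s & forall t : R, s < t -> A `<=` t `*: V.

Definition bounded_setfun (R : realType) (X : Type)
    (Y : topologicalLmodType R) : set (X -> set Y) :=
  [set u | (forall x, u x !=set0) /\ tvs_bounded (\bigcup_x u x)].

Section subconvexlike.
Context (R : realType) (X : topologicalLmodType R) (Y : tvsType R).
Variables (Yp : set Y) (D : set X) (f : X -> set Y).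

Definition subconvexlike : Prop :=
  exists2 theta : Y, Yp° theta &
  forall x1 x2 : X, D x1 -> D x2 ->
  forall alpha : R, 0 < alpha < 1 ->
  forall eps : R, 0 < eps ->
  exists2 x3 : X, D x3 &
    (eps *: theta) `+: (alpha `*: f x1 `+` (1 - alpha) `*: f x2)
      `<=` f x3 `+` Yp.

(* The same [x3] must serve all [x], as the inclusion involves the whole range
   of [u]. *)
Definition sub_convexlike : Prop :=
  exists2 u : X -> set Y, bounded_setfun u &
  forall x1 x2 : X, D x1 -> D x2 ->
  forall alpha : R, 0 < alpha < 1 ->
  forall eps : R, 0 < eps ->
  exists2 x3 : X, D x3 &
    forall x : X,
      eps `*: u x `+` (alpha `*: f x1 `+` (1 - alpha) `*: f x2)
        `<=` f x3 `+` Yp.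

Definition strictly_subconvexlike : Prop :=
  exists2 theta : Y, Yp° theta &
  forall x1 x2 : X, D x1 -> D x2 ->
  forall alpha : R, 0 < alpha < 1 ->
  forall eps : R, 0 < eps ->
  exists2 x3 : X, D x3 &
    (eps *: theta) `+: (alpha `*: f x1 `+` (1 - alpha) `*: f x2)
      `<=` f x3 `+` Yp°.

Definition strictly_sub_convexlike : Prop :=
  exists2 u : X -> set Y, bounded_setfun u &
  forall x1 x2 : X, D x1 -> D x2 ->
  forall alpha : R, 0 < alpha < 1 ->
  forall eps : R, 0 < eps ->
  exists2 x3 : X, D x3 &
    forall x : X,
      eps `*: u x `+` (alpha `*: f x1 `+` (1 - alpha) `*: f x2)
        `<=` f x3 `+` Yp°.

End subconvexlike.

(* Main.v *)
Require Import Defs.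
From HB Require Import structures.
From mathcomp Require Import all_boot all_order all_algebra.
From mathcomp Require Import all_classical all_reals all_analysis.

Import Order.TTheory GRing.Theory Num.Theory.

Local Open Scope classical_set_scope.
Local Open Scope ring_scope.

(** Two facts carry the equivalence: singletons are bounded, and an interior
    point of the cone dominates a positive multiple of any vector.

    By the first, the constant set-valued function with value {theta} is
    an admissible [u], so each property stated with an interior point [theta]
    implies its counterpart stated with a bounded [u]; and strict properties
    imply the corresponding nonstrict ones because the interior of the cone lies
    in the cone. What remains is [sub_convexlike_strictly]: a bounded [u] with
    the nonstrict condition already yields the strict condition for every
    interior point [theta].

    For that, let [b] be a value of [u]. Since [theta - v] is interior for all
    [v] near 0, some [t > 0] makes [theta - t^-1 *: b] interior
    ([interior_absorbs]). To treat a given [eps], apply the hypothesis with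
    [eps / t] in place of [eps] and split
    [eps *: theta + a = ((eps / t) *: b + a) + eps *: (theta - t^-1 *: b)].
    The first term lies in [f x3 + Yp]; adding the second, a positive multiple
    of an interior point, moves the cone component into the interior
    ([cone_interior_scaleD]). As [t] depends only on [b] and [theta], it can be
    fixed before [x1], [x2] and [eps] are given. *)

Lemma scaler_continuous {R : realType} {Y : topologicalLmodType R} (y : Y) :
  continuous (fun r : R^o => r *: y).
Proof.
move=> r; have yr : (fun=> y) @ r --> y by exact: cvg_cst.
exact: (cvg_comp2 (@cvg_id _ (nbhs r)) yr (@scale_continuous R Y (r, y))).
Qed.

Lemma scalel_continuous {R : realType} {Y : topologicalLmodType R} (c : R) :
  continuous (fun y : Y => c *: y).
Proof.
move=> y; have cy : (fun=> c : R^o) @ y --> (c : R^o) by exact: cvg_cst.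
exact: (cvg_comp2 cy (@cvg_id _ (nbhs y)) (@scale_continuous R Y (c, y))).
Qed.

Lemma addl_continuous {Y : topologicalZmodType} (x : Y) :
  continuous (fun y : Y => x + y).
Proof.
move=> y; have xy : (fun=> x) @ y --> x by exact: cvg_cst.
exact: (cvg_comp2 xy (@cvg_id _ (nbhs y)) (@add_continuous Y (x, y))).
Qed.

(** Scaling is continuous, so [r *: y] lies in a given neighbourhood of 0 as soon
    as [`|r| < e]; hence [t^-1 *: y] does for all [t > e^-1]. *)
Lemma tvs_bounded_set1 {R : realType} {Y : topologicalLmodType R} (y : Y) :
  tvs_bounded [set y].
Proof.
move=> V V0.
have /nbhs_ballP[e /= e0 eV] : nbhs (0 : R^o) [set r | V (r *: y)].
  by apply: (scaler_continuous y 0); rewrite /= scale0r.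
exists e^-1; first by rewrite invr_gt0.
move=> t et _ ->.
have t0 : 0 < t by apply: lt_trans et; rewrite invr_gt0.
exists (t^-1 *: y); last by rewrite scalerA divff ?scale1r ?gt_eqF.
apply: eV; rewrite /ball /= sub0r normrN gtr0_norm ?invr_gt0//.
by rewrite invf_plt.
Qed.

Lemma bounded_setfun_cst {R : realType} {X : Type}
    {Y : topologicalLmodType R} (y : Y) :
  bounded_setfun (fun _ : X => [set y]).
Proof.
split=> [x|V /(tvs_bounded_set1 y)[s s0 sV]]; first by exists y.
by exists s => // t /sV yV z [x _ zy]; apply: yV.
Qed.

(** The point [z := c *: i + y] is sent to [i] by the continuous map
    [w |-> c^-1 *: (- y + w)], and any [w] sent into the cone lies in the cone. *)
Lemma cone_interior_scaleD {R : realType} {Y : topologicalLmodType R}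
    {Yp : set Y} {i y : Y} {c : R} :
  convex_cone Yp -> Yp° i -> Yp y -> 0 < c -> Yp° (c *: i + y).
Proof.
move=> coneYp Yi Yy c0.
have cN0 : c != 0 by rewrite gt_eqF.
have : nbhs (c *: i + y) [set w | Yp (c^-1 *: (- y + w))].
  apply: (addl_continuous (- y) _ [set v | Yp (c^-1 *: v)]).
  apply: (scalel_continuous c^-1 _ Yp).
  by rewrite addrC addrK scalerA mulVf// scale1r.
apply: filterS => w /= Yw.
have -> : w = c *: (c^-1 *: (- y + w)) + 1 *: y.
  by rewrite scalerA divff// !scale1r addrC addNKr.
by apply: coneYp => //; exact: ltW.
Qed.

(** Near 0 every [v] keeps [theta - v] interior, and boundedness of the singleton
    {b} brings [t^-1 *: b] into that neighbourhood. *)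
Lemma interior_absorbs {R : realType} {Y : topologicalLmodType R}
    {Yp : set Y} {theta : Y} (b : Y) :
  Yp° theta -> exists2 t : R, 0 < t & Yp° (theta - t^-1 *: b).
Proof.
move=> Ytheta.
have V0 : nbhs (0 : Y) [set v | Yp° (theta - v)].
  apply: (@opp_continuous Y 0 [set v | Yp° (theta + v)]).
  apply: (addl_continuous theta).
  by rewrite oppr0 addr0; apply: open_nbhs_nbhs; split=> //; exact: open_interior.
have [s s0 sb] := tvs_bounded_set1 (R := R) b _ V0.
have s1 : s < s + 1 by rewrite ltrDl.
have t0 : 0 < s + 1 by exact: lt_trans s1.
exists (s + 1) => //; have [v Yv <-] := sb _ s1 _ erefl.
by rewrite scalerA mulVf ?scale1r ?gt_eqF.
Qed.

Lemma subconvexlike_sub_convexlike {R : realType} {X : topologicalLmodType R}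
    {Y : tvsType R} {Yp : set Y} {D : set X} {f : X -> set Y} :
  subconvexlike Yp D f -> sub_convexlike Yp D f.
Proof.
move=> [theta _ H]; exists (fun=> [set theta]).
  exact: bounded_setfun_cst.
move=> x1 x2 Dx1 Dx2 a a01 e e0.
have [x3 Dx3 sub] := H _ _ Dx1 Dx2 _ a01 _ e0; exists x3 => // _.
by move=> _ [_ [_ -> <-]] [z fz <-]; apply: sub; exists z.
Qed.

Lemma sub_convexlike_strictly {R : realType} {X : topologicalLmodType R}
    {Y : tvsType R} {Yp : set Y} {D : set X} {f : X -> set Y} :
  convex_cone Yp -> Yp° !=set0 ->
  sub_convexlike Yp D f -> strictly_subconvexlike Yp D f.
Proof.
move=> coneYp [theta Ytheta] [u [u0 _] H]; exists theta => //.
have [b ub] := u0 0.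
have [t t0 Yb] := interior_absorbs b Ytheta.
move=> x1 x2 Dx1 Dx2 a a01 e e0.
have [x3 Dx3 sub] := H _ _ Dx1 Dx2 _ a01 _ (divr_gt0 e0 t0).
exists x3 => // _ [z fz <-].
have [|y fy [k Yk yk]] := sub 0 ((e / t) *: b + z).
  by exists ((e / t) *: b); [exists b | exists z].
exists y => //; exists (e *: (theta - t^-1 *: b) + k).
  exact: cone_interior_scaleD.
by rewrite addrCA yk scalerBr scalerA addrA subrK.
Qed.

Lemma strictly_subconvexlike_strictly_sub_convexlike {R : realType}
    {X : topologicalLmodType R} {Y : tvsType R} {Yp : set Y} {D : set X}
    {f : X -> set Y} :
  strictly_subconvexlike Yp D f -> strictly_sub_convexlike Yp D f.
Proof.
move=> [theta _ H]; exists (fun=> [set theta]).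
  exact: bounded_setfun_cst.
move=> x1 x2 Dx1 Dx2 a a01 e e0.
have [x3 Dx3 sub] := H _ _ Dx1 Dx2 _ a01 _ e0; exists x3 => // _.
by move=> _ [_ [_ -> <-]] [z fz <-]; apply: sub; exists z.
Qed.

Lemma set_addS {V : zmodType} (A B C : set V) :
  B `<=` C -> set_add A B `<=` set_add A C.
Proof. by move=> BC _ [a Aa [b /BC Cb <-]]; exists a => //; exists b. Qed.

Lemma strictly_subconvexlikeW {R : realType} {X : topologicalLmodType R}
    {Y : tvsType R} {Yp : set Y} {D : set X} {f : X -> set Y} :
  strictly_subconvexlike Yp D f -> subconvexlike Yp D f.
Proof.
move=> [theta Ytheta H]; exists theta => // x1 x2 Dx1 Dx2 a a01 e e0.
have [x3 Dx3 sub] := H _ _ Dx1 Dx2 _ a01 _ e0; exists x3 => //.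
by apply: subset_trans sub _; apply: set_addS; exact: interior_subset.
Qed.

Lemma strictly_sub_convexlikeW {R : realType} {X : topologicalLmodType R}
    {Y : tvsType R} {Yp : set Y} {D : set X} {f : X -> set Y} :
  strictly_sub_convexlike Yp D f -> sub_convexlike Yp D f.
Proof.
move=> [u ubnd H]; exists u => // x1 x2 Dx1 Dx2 a a01 e e0.
have [x3 Dx3 sub] := H _ _ Dx1 Dx2 _ a01 _ e0; exists x3 => // x.
by apply: subset_trans (sub x) _; apply: set_addS; exact: interior_subset.
Qed.

Theorem theorem1 (R : realType) (X : topologicalLmodType R) (Y : tvsType R)
    (Yp : set Y) (hYp : convex_cone Yp) (hint : Yp° !=set0)
    (D : set X) (hD : D !=set0) (f : X -> set Y) :
  [<-> subconvexlike Yp D f;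
       sub_convexlike Yp D f;
       strictly_subconvexlike Yp D f;
       strictly_sub_convexlike Yp D f].
Proof.
tfae.
- exact: subconvexlike_sub_convexlike.
- exact: sub_convexlike_strictly.
- exact: strictly_subconvexlike_strictly_sub_convexlike.
- move=> /strictly_sub_convexlikeW /(sub_convexlike_strictly hYp hint).
  exact: strictly_subconvexlikeW.
Qed.
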